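(* Let $q$ be a positive integer, let $n\ge 1$, and let $c_1\ge c_2\ge\dots\ge c_n$ be positive integers. Let $j\in\{1,\dots,n\}$ and let $\delta_j$ be an integer with $\delta_j\ge j$. Let $V_j^\star(\delta_j)$ denote the optimal value of the problem ($\mathrm{DPF}_j$): $$V_j^\star(\delta_j)=\max\left\{\sum_{i=1}^{j}\pi(x_i)\ :\ \sum_{i=1}^{j}x_i\le\delta_j,\ \ x_i\in\{0,1,\dots,c_i\}\ \text{ for } i=1,\dots,j\right\}.$$ For $\ell\in\{1,\dots,j\}$ put $$\lambda_\ell=(\delta_j-j+1)-\sum_{r=1}^{\ell-1}\bigl(\theta(c_r)-1\bigr),$$ and let $\ell_j$ be the largest integer $\ell\in\{1,\dots,j\}$ such that $\lambda_{\ell}\ge 1$. Then $$V_j^\star(\delta_j)=j-1+\pi\bigl(\min(\lambda_{\ell_j},c_{\ell_j})\bigr)+\sum_{i=1}^{\ell_j-1}\bigl(\pi(c_i)-1\bigr).$$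
   Context: Let $Q=\frac{q+1}{2}$. The function $\pi$ from non-negative integers to non-negative integers is defined by $$\pi(\alpha)=\begin{cases}\lceil \alpha/q\rceil & \text{if } \alpha\le q,\\ \left\lceil \frac{\alpha-q}{\lceil Q\rceil}\right\rceil+1 & \text{if } \alpha>q.\end{cases}$$ The function $\theta$ from non-negative integers to non-negative integers is defined by $$\theta(\alpha)=\begin{cases}\pi(\alpha) & \text{if } \alpha\le q,\\ (\pi(\alpha)-1)\lceil Q\rceil+\lfloor Q\rfloor & \text{if } \alpha>q.\end{cases}$$ Interpretation: $q$ is the vehicle capacity, $c_i$ is the capacity of depot $i$, $x_i$ is the quantity delivered to depot $i$, and $V_j^\star(\delta_j)$ is the maximum number of vehicles required to deliver $\delta_j$ units of demand to depots $1,\dots,j$. Empty sums are $0$. *)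

(* Defs.v *)
From mathcomp Require Import all_boot all_order all_algebra.
Set Implicit Arguments. Unset Strict Implicit. Unset Printing Implicit Defensive.
Import Order.TTheory GRing.Theory Num.Theory.
Local Open Scope ring_scope.

(* In the definitions below, q is the vehicle capacity and c i the capacity of
   depot i. Depots are numbered from 1, so c is only ever read at 1 <= i <= n. *)

Definition Qhalf (q : nat) : rat := (q%:R + 1) / 2%:R.

(* pif and thetaf take values in the non-negative integers: the roundings are of
   non-negative rationals, so the absolute value `|_|%N is only a cast
   from int to nat. *)
Definition pif (q a : nat) : nat :=
  if (a <= q)%N then `|Num.ceil (a%:R / q%:R : rat)|%N
  else (`|Num.ceil ((a%:R - q%:R) / (Num.ceil (Qhalf q))%:~R : rat)| + 1)%N.

(* For a > q we have pif q a >= 2, so the subtraction is not truncated. *)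
Definition thetaf (q a : nat) : nat :=
  if (a <= q)%N then pif q a
  else ((pif q a - 1) * `|Num.ceil (Qhalf q)| + `|Num.floor (Qhalf q)|)%N.

(* A candidate x assigns to i : 'I_j the delivery to depot i.+1, a value in
   {0, ..., c i.+1}. For d >= 0 the zero delivery is feasible, so this is a
   maximum over a nonempty finite set. *)
Definition Vstar (q : nat) (c : nat -> nat) (j : nat) (d : int) : nat :=
  (\max_(x : {dffun forall i : 'I_j, 'I_(c i.+1).+1}
         | ((\sum_(i < j) x i)%N%:Z <= d)%R) \sum_(i < j) pif q (x i))%N.

Definition lambdaf (q : nat) (c : nat -> nat) (j : nat) (d : int) (l : nat) : int :=
  (d - j%:Z + 1) - \sum_(1 <= r < l) ((thetaf q (c r))%:Z - 1).

(* The largest l in {1, ..., j} with lambdaf l >= 1; when 1 <= j <= d such an l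
   exists, because lambdaf 1 = d - j + 1 >= 1. *)
Definition ell (q : nat) (c : nat -> nat) (j : nat) (d : int) : nat :=
  (\max_(1 <= l < j.+1 | (1 <= lambdaf q c j d l)%R) l)%N.

(* Main.v *)
(* Give one unit, hence one vehicle, to every depot and spend the remaining
   [d - j] units on extra vehicles: the first extra vehicle of a depot costs [q]
   units and each further one costs [C = ceil Q <= q]. Thus [E] extra vehicles
   spread over [s] depots cost [s (q - C) + C E] units, so one wants as few
   depots as possible, and filling the depots by decreasing capacity is optimal.
   A depot left without any delivery frees one unit but loses one vehicle, and
   a freed unit buys at most one extra vehicle. *)
Require Import Defs.
From mathcomp Require Import all_boot all_order all_algebra.
From mathcomp Require Import zify lra.
Import Order.TTheory GRing.Theory Num.Theory.
Local Open Scope ring_scope.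

(** * Integer closed forms of [pif] and [thetaf] *)

Lemma natr_half (q : nat) : q%:R = (odd q)%:R + 2 * (q./2)%:R :> rat.
Proof. by rewrite -natrM -natrD mul2n odd_double_half. Qed.

Lemma ceil_Qhalf (q : nat) : Num.ceil (Qhalf q) = (q./2.+1)%:Z.
Proof.
apply: ceil_def; rewrite /Qhalf natr_half.
have -> : (q./2.+1%:Z - 1 = (q./2)%:Z)%R by lia.
rewrite -!pmulrn -[(q./2).+1%:R]natr1.
by case: (odd q); rewrite /= ?mulr1n ?mulr0n; apply/andP; split; lra.
Qed.

Lemma floor_Qhalf (q : nat) : Num.floor (Qhalf q) = (uphalf q)%:Z.
Proof.
apply: floor_def; rewrite /Qhalf natr_half uphalf_half.
rewrite intrD -!pmulrn natrD.
by case: (odd q); rewrite /= ?mulr1n ?mulr0n; apply/andP; split; lra.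
Qed.

Lemma ceil_divn (b m : nat) : (0 < m)%N ->
  Num.ceil (b.+1%:R / m%:R : rat) = ((b %/ m).+1)%:Z.
Proof.
move=> m0; apply: ceil_def.
have mr : 0 < m%:R :> rat by rewrite ltr0n.
rewrite ltr_pdivlMr // ler_pdivrMr //.
have -> : ((b %/ m).+1%:Z - 1 = (b %/ m)%:Z)%R by lia.
rewrite -!pmulrn -!natrM ltr_nat ler_nat.
by have := divn_eq b m; have := ltn_pmod b m0; lia.
Qed.

Lemma pifE (q a : nat) : (0 < q)%N ->
  pif q a = if (a <= q)%N then (0 < a : nat)%N
            else ((a - q.+1) %/ q./2.+1).+2.
Proof.
move=> q0; rewrite /pif; case: ifP => [|/negbT aq].
  case: a => [|a] aq; first by rewrite mul0r ceil0.
  by rewrite ceil_divn // divn_small.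
rewrite ceil_Qhalf -natrB; last by lia.
have -> : (a - q = (a - q.+1).+1)%N by lia.
by rewrite -pmulrn ceil_divn //= addn1.
Qed.

(** Ceiling and floor of [Qhalf q] add up to [q.+1], so one of the [pif q a - 1] copies of the
    ceiling merges with the floor. *)
Lemma thetafE (q a : nat) : (0 < q)%N ->
  thetaf q a = if (a <= q)%N then (0 < a : nat)%N
               else (q.+1 + ((a - q.+1) %/ q./2.+1) * q./2.+1)%N.
Proof.
move=> q0; rewrite /thetaf pifE //; case: (leqP a q) => aq //.
rewrite ceil_Qhalf floor_Qhalf /= uphalf_half.
by have := odd_double_half q; nia.
Qed.

(** * Thresholds and vehicle costs of a single depot *)

Lemma leq_pif (q : nat) : (0 < q)%N -> {homo pif q : a b / (a <= b)%N}.
Proof.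
move=> q0 a b ab; rewrite !pifE //.
case: (leqP a q) => aq; case: (leqP b q) => bq; [lia | | lia | ].
  by case: (0 < a)%N.
by rewrite !ltnS leq_div2r //; lia.
Qed.

Lemma pif_gt0 (q a : nat) : (0 < q)%N -> (0 < pif q a)%N = (0 < a)%N.
Proof.
move=> q0; rewrite pifE //; case: (leqP a q) => aq; first by case: (0 < a)%N.
by rewrite (leq_ltn_trans _ aq).
Qed.

Lemma thetaf_le (q a : nat) : (0 < q)%N -> (thetaf q a <= a)%N.
Proof.
move=> q0; rewrite thetafE //; case: ifP => aq; first by lia.
by have := leq_divM (a - q.+1) q./2.+1; lia.
Qed.

Lemma pif_thetaf (q a : nat) : (0 < q)%N -> pif q (thetaf q a) = pif q a.
Proof.
move=> q0; rewrite pifE // (pifE _ a) // thetafE //.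
case: (leqP a q) => aq; first by case: a aq => [|a] aq; rewrite ?q0.
rewrite leqNgt leq_addr /=.
by rewrite addKn mulnK.
Qed.

(** One unit pays for the first vehicle, [q] for the second and [q./2.+1] for each further one; the
    term added on the left avoids a subtraction. *)
Lemma thetaf_cost (q a : nat) : (0 < q)%N -> (0 < a)%N ->
  (thetaf q a + q./2.+1 * (1 < pif q a) =
   1 + q * (1 < pif q a) + q./2.+1 * (pif q a).-1)%N.
Proof.
move=> q0 a0; rewrite thetafE // pifE //.
case: (leqP a q) => aq; first by rewrite a0 /=; lia.
by rewrite /=; nia.
Qed.

(** The right-hand side is the price, in the sense of [thetaf_cost], of one vehicle more than
    [pif q a]. *)
Lemma ltn_thetaf_next (q a : nat) : (0 < q)%N -> (0 < a)%N ->
  (a < 1 + q + q./2.+1 * (pif q a).-1)%N.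
Proof.
move=> q0 a0; rewrite pifE //.
case: (leqP a q) => aq; first by lia.
rewrite /=; have := divn_eq (a - q.+1) q./2.+1.
by have := ltn_pmod (a - q.+1) (ltn0Sn q./2); nia.
Qed.

(** With [thetaf_le] and [pif_thetaf], this makes [thetaf q b] the least load that uses [pif q b]
    vehicles. *)
Lemma pif_lt_thetaf (q a b : nat) : (0 < q)%N ->
  (a < thetaf q b)%N -> (pif q a < pif q b)%N.
Proof.
move=> q0; rewrite thetafE // !pifE //.
case: (leqP b q) => bq; first by case: (0 < b)%N => //; case: a.
case: (leqP a q) => aq; first by case: (0 < a)%N.
by rewrite (ltnS _.+1) ltnS ltn_divLR //; move: (_ * _)%N => p; lia.
Qed.

(** * Bounds summed over the depots *)

Lemma antitone_on (n : nat) (c : nat -> nat) :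
  (forall i, (1 <= i < n)%N -> (c i.+1 <= c i)%N) ->
  forall a b, (1 <= a)%N -> (a <= b <= n)%N -> (c b <= c a)%N.
Proof.
move=> hc a b a1; elim: b => [|b IH] /andP[ab bn]; first by lia.
move: ab; rewrite leq_eqVlt => /predU1P[-> //|ab].
by apply: (leq_trans (hc b _) (IH _)); lia.
Qed.

(* The Lagrangian bound: [c m.+1] is the value at which the extra vehicles of a
   depot are priced. *)
Lemma extra_vehicles_bound (q n : nat) (c : nat -> nat) (j m : nat)
    (x : 'I_j -> nat) : (0 < q)%N ->
  (forall i, (1 <= i < n)%N -> (c i.+1 <= c i)%N) ->
  (j <= n)%N -> (m < j)%N -> (forall i, (x i <= c i.+1)%N) ->
  (\sum_(i < j) (pif q (x i)).-1 + m * (pif q (c m.+1)).-1 <=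
   \sum_(i < m) (pif q (c i.+1)).-1 +
   (pif q (c m.+1)).-1 * \sum_(i < j) (1 < pif q (x i)))%N.
Proof.
move=> q0 hc jn mj xc.
have -> : (m * (pif q (c m.+1)).-1 = \sum_(i < m) (pif q (c m.+1)).-1)%N.
  by rewrite sum_nat_const card_ord.
rewrite (big_ord_widen j (fun=> (pif q (c m.+1)).-1) (ltnW mj)).
rewrite (big_ord_widen j (fun i => (pif q (c i.+1)).-1) (ltnW mj)).
rewrite !(big_mkcond (fun i : 'I_j => (i < m)%N)) big_distrr -!big_split /=.
apply: leq_sum => i _; have e1 := leq_pif _ q0 _ _ (xc i).
have ij := ltn_ord i.
(* The bound holds depot by depot: before [m], the capacity yields at least [(pif q (c m.+1)).-1]
   extra vehicles; from [m] on, at most that many. *)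
case: (ltnP i m) => im.
  have : (c m.+1 <= c i.+1)%N by apply: (antitone_on _ _ hc); lia.
  by move/(leq_pif _ q0); case: ltnP; nia.
have : (c i.+1 <= c m.+1)%N by apply: (antitone_on _ _ hc); lia.
by move/(leq_pif _ q0); case: ltnP; nia.
Qed.

Lemma sum_predn (m : nat) (f : 'I_m -> nat) : (forall i, (0 < f i)%N) ->
  (\sum_(i < m) f i = \sum_(i < m) (f i).-1 + m)%N.
Proof.
move=> f0; have sm : (\sum_(i < m) 1)%N = m by rewrite sum1_card card_ord.
rewrite -[X in _ = (_ + X)%N]sm -big_split /=.
by apply: eq_bigr => i _; rewrite addn1 prednK.
Qed.

(** As [0.-1 = 0], the right-hand side credits an empty depot with a vehicle; the count of empty
    depots corrects this. *)
Lemma sum_pif_pred (q j : nat) (x : 'I_j -> nat) : (0 < q)%N ->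
  (\sum_(i < j) pif q (x i) + \sum_(i < j) (x i == 0%N) =
   \sum_(i < j) (pif q (x i)).-1 + j)%N.
Proof.
move=> q0; have sj : (\sum_(i < j) 1)%N = j by rewrite sum1_card card_ord.
rewrite -[X in _ = (_ + X)%N]sj -!big_split /=; apply: eq_bigr => i _.
by have := pif_gt0 q (x i) q0; lia.
Qed.

(** A nonzero load is at least its threshold, priced by [thetaf_cost]; an empty depot is charged the
    unit it saves. *)
Lemma sum_cost (q j : nat) (x : 'I_j -> nat) : (0 < q)%N ->
  (j + q * \sum_(i < j) (1 < pif q (x i)) +
     q./2.+1 * \sum_(i < j) (pif q (x i)).-1 <=
   \sum_(i < j) x i + \sum_(i < j) (x i == 0%N) +
     q./2.+1 * \sum_(i < j) (1 < pif q (x i)))%N.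
Proof.
move=> q0; have sj : (\sum_(i < j) 1)%N = j by rewrite sum1_card card_ord.
rewrite -[X in (X + _ + _ <= _)%N]sj !big_distrr -!big_split /=; apply: leq_sum => i _.
case: (posnP (x i)) => [-> | xi]; first by rewrite pifE //= !muln0.
by have := thetaf_cost q _ q0 xi; have := thetaf_le q (x i) q0; lia.
Qed.

(** The earlier capacities are no smaller than [c m.+1], so they too need a second vehicle and every
    indicator in [thetaf_cost] is 1. *)
Lemma sum_thetaf (q n : nat) (c : nat -> nat) (m : nat) : (0 < q)%N ->
  (forall i, (1 <= i <= n)%N -> (0 < c i)%N) ->
  (forall i, (1 <= i < n)%N -> (c i.+1 <= c i)%N) ->
  (m < n)%N -> (1 < pif q (c m.+1))%N ->
  (\sum_(i < m) thetaf q (c i.+1) + q./2.+1 * m =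
   m + q * m + q./2.+1 * \sum_(i < m) (pif q (c i.+1)).-1)%N.
Proof.
move=> q0 hp hc mn km.
have : (\sum_(i < m) (thetaf q (c i.+1) + q./2.+1) =
        \sum_(i < m) (1 + q + q./2.+1 * (pif q (c i.+1)).-1))%N; last first.
  rewrite !big_split -big_distrr !sum_nat_const card_ord /=; lia.
apply: eq_bigr => i _.
have im := ltn_ord i; have ci : (0 < c i.+1)%N by apply: hp; lia.
have : (c m.+1 <= c i.+1)%N by apply: (antitone_on _ _ hc); lia.
move/(leq_pif _ q0) => kk; have := thetaf_cost q _ q0 ci.
have -> : (1 < pif q (c i.+1))%N by lia.
by lia.
Qed.

(** * Optimality of the greedy delivery *)

(** An upper bound and a witness, both over plain functions, so that dependent finite functions
    appear only here. *)
Lemma Vstar_eq (q : nat) (c : nat -> nat) (j b v : nat) (y : nat -> nat) :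
  (forall x : 'I_j -> nat, (forall i, (x i <= c i.+1)%N) ->
     (\sum_(i < j) x i <= b)%N -> (\sum_(i < j) pif q (x i) <= v)%N) ->
  (forall i : 'I_j, (y i <= c i.+1)%N) ->
  (\sum_(i < j) y i <= b)%N -> (\sum_(i < j) pif q (y i) = v)%N ->
  Vstar q c j b = v.
Proof.
move=> ub yc yb yv; apply/eqP; rewrite eqn_leq; apply/andP; split.
  apply/bigmax_leqP => x xb; apply: (ub (fun i => nat_of_ord (x i))) => // i.
  by have := ltn_ord (x i); lia.
pose x : {dffun forall i : 'I_j, 'I_(c i.+1).+1} := finfun (fun i : 'I_j => inord (y i)).
have xE i : x i = y i :> nat by rewrite ffunE inordK // ltnS yc.
apply: (bigop.bigmax_sup x).
  by rewrite lez_nat (eq_bigr (fun i : 'I_j => y i)).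
by rewrite (eq_bigr (fun i : 'I_j => pif q (y i))) ?yv // => i _; rewrite xE.
Qed.

Section Greedy.
Variables (q n : nat) (c : nat -> nat) (j m a : nat).
Hypotheses (q0 : (0 < q)%N) (mj : (m < j)%N) (jn : (j <= n)%N) (a0 : (0 < a)%N).
Hypothesis c_gt0 : forall i, (1 <= i <= n)%N -> (0 < c i)%N.
Hypothesis c_noninc : forall i, (1 <= i < n)%N -> (c i.+1 <= c i)%N.

(* [a] is what the greedy delivery leaves for depot [m.+1], one unit being
   reserved for each later depot. *)
Let budget := (\sum_(i < m) thetaf q (c i.+1) + a + (j - m.+1))%N.
Let value := (\sum_(i < m) (pif q (c i.+1)).-1 + j.-1 + pif q (minn a (c m.+1)))%N.

(** If [a] reaches the threshold of the last depot, monotonicity bounds each term. Otherwise one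
    more vehicle would cost at least the bound of [ltn_thetaf_next], which exceeds [a]. *)
Lemma greedy_optimal (x : 'I_j -> nat) :
  (m.+1 = j \/ (a < thetaf q (c m.+1))%N) ->
  (forall i, (x i <= c i.+1)%N) -> (\sum_(i < j) x i <= budget)%N ->
  (\sum_(i < j) pif q (x i) <= value)%N.
Proof.
rewrite /budget /value => stop xc xd.
have cm : (0 < c m.+1)%N by apply: c_gt0; lia.
have hP := sum_pif_pred q j x q0.
case: (ltnP a (thetaf q (c m.+1))) => [am|ma]; last first.
  have pm : pif q (minn a (c m.+1)) = pif q (c m.+1).
    apply/eqP; rewrite eqn_leq leq_pif ?geq_minr //=.
    rewrite -{1}pif_thetaf //; apply: leq_pif => //.
    by rewrite leq_min ma thetaf_le.
  have mj' : j = m.+1 by case: stop => //; lia.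
  have : (\sum_(i < j) (pif q (x i)).-1 <= \sum_(i < j) (pif q (c i.+1)).-1)%N.
    by apply: leq_sum => i _; have := leq_pif q q0 _ _ (xc i); lia.
  have -> : (\sum_(i < j) (pif q (c i.+1)).-1 =
             \sum_(i < m) (pif q (c i.+1)).-1 + (pif q (c m.+1)).-1)%N.
    by rewrite mj' big_ord_recr.
  by have := pif_gt0 q (c m.+1) q0; lia.
have -> : minn a (c m.+1) = a by have := thetaf_le q (c m.+1) q0; lia.
have pa := pif_lt_thetaf q _ _ q0 am.
have pa0 : (0 < pif q a)%N by rewrite pif_gt0.
have anext := ltn_thetaf_next q a q0 a0.
have hT := sum_thetaf q n c m q0 c_gt0 c_noninc (leq_trans mj jn).
have {}hT := hT ltac:(lia).
have hE := extra_vehicles_bound q n c j m x q0 c_noninc jn mj xc.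
have hX := sum_cost q j x q0.
have hC : (0 < q./2.+1 <= q)%N by lia.
move: hT hE hX hP xd anext pa hC.
move: (\sum_(i < m) thetaf _ _)%N (\sum_(i < j) (pif _ _).-1)%N => T E.
move: (\sum_(i < m) (pif _ _).-1)%N (\sum_(i < j) pif _ _)%N => K P.
move: (\sum_(i < j) x i)%N (\sum_(i < j) (x i == 0))%N => X Z.
move: (\sum_(i < j) (1 < _))%N (q./2.+1) => S C.
move=> hT hE hX hP xd anext pa /andP[C0 hC].
rewrite leqNgt; apply/negP => big.
have hKE : (K + pif q a + Z <= E)%N by lia.
(* If only [m] depots had extra vehicles, [hE] would give at most [K] of them, against [hKE]. *)
have mS : (m < S)%N.
  rewrite ltnNge; apply/negP => Sm.
  by have := leq_mul (leqnn (pif q (c m.+1)).-1) Sm; lia.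
have hCE := leq_mul (leqnn C) hKE.
have hS := leq_mul (leqnn (q - C)) mS.
(* Each unit freed by an empty depot is outweighed by the replacement vehicle, which costs
   [C >= 1]. *)
have hZ : (Z <= C * Z)%N by rewrite leq_pmull.
clear -hT hX anext hCE hS xd hZ pa0 mj hC.
move: pa0 anext hCE; case: (pif q a) => // e _ /= anext hCE.
have qE := subnK hC; move: (q - C)%N qE hS => u qE hS; subst q.
lia.
Qed.

(** Indices start at 0. Loading up to [thetaf] instead of the full capacity gives the same vehicles
    at least cost. *)
Definition greedy (i : nat) : nat :=
  if (i < m)%N then thetaf q (c i.+1)
  else if i == m then minn a (c m.+1) else 1%N.

Lemma greedy_le (i : 'I_j) : (greedy i <= c i.+1)%N.
Proof.
rewrite /greedy; case: ifP => _; first exact: thetaf_le.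
case: eqP => [->|_]; first exact: geq_minr.
by apply: c_gt0; have := ltn_ord i; lia.
Qed.

Lemma sum_at_greedy (f : nat -> nat) :
  (\sum_(i < j) f (greedy i) =
   \sum_(i < m) f (thetaf q (c i.+1)) + f (minn a (c m.+1))
   + (j - m.+1) * f 1)%N.
Proof.
rewrite -(big_mkord xpredT (fun i => f (greedy i))).
rewrite (big_cat_nat (leq0n m.+1) mj) big_nat_recr //= big_mkord.
congr (_ + _ + _)%N.
- by apply: eq_bigr => i _; rewrite /greedy ltn_ord.
- by rewrite /greedy ltnn eqxx.
- rewrite -(sum_nat_const_nat m.+1 j (f 1%N)) big_nat [RHS]big_nat.
  apply: eq_bigr => i /andP[mi _].
  by rewrite /greedy ifF ?ifF //; lia.
Qed.

Lemma greedy_feasible : (\sum_(i < j) greedy i <= budget)%N.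
Proof. by rewrite (sum_at_greedy id) /budget; have := geq_minl a (c m.+1); lia. Qed.

Lemma greedy_value : (\sum_(i < j) pif q (greedy i) = value)%N.
Proof.
have p1 : pif q 1 = 1%N by rewrite pifE // q0.
rewrite (sum_at_greedy (pif q)) /value p1 muln1.
have -> : (\sum_(i < m) pif q (thetaf q (c i.+1)) =
           \sum_(i < m) (pif q (c i.+1)).-1 + m)%N.
  rewrite -sum_predn; first by apply: eq_bigr => i _; rewrite pif_thetaf.
  by move=> i; rewrite pif_gt0 // c_gt0 //; have := ltn_ord i; lia.
by lia.
Qed.

Lemma Vstar_greedy :
  m.+1 = j \/ (a < thetaf q (c m.+1))%N -> Vstar q c j budget = value.
Proof.
move=> stop; apply: (Vstar_eq _ _ _ _ _ greedy).
- by move=> x; apply: greedy_optimal.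
- exact: greedy_le.
- exact: greedy_feasible.
- exact: greedy_value.
Qed.
End Greedy.

(** * The stopping index [ell] and the final formula *)

Lemma sum_subz1 (f : nat -> nat) (m : nat) :
  \sum_(1 <= i < m.+1) ((f i)%:Z - 1) = (\sum_(i < m) f i.+1)%N%:Z - m%:Z.
Proof.
elim: m => [|m IH]; first by rewrite big_geq // big_ord0.
by rewrite big_nat_recr //= IH big_ord_recr /=; lia.
Qed.

Lemma ellP (q : nat) (c : nat -> nat) (j : nat) (d : int) :
  (0 < j)%N -> j%:Z <= d ->
  let l := ell q c j d in
  [/\ (1 <= l <= j)%N, 1 <= lambdaf q c j d l &
      l = j \/ lambdaf q c j d l.+1 <= 0].
Proof.
move=> j0 jd l.
have max_l k : (1 <= k <= j)%N -> 1 <= lambdaf q c j d k -> (k <= l)%N.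
  move=> kj k1; apply: (@leq_bigmax_seq _ _ _ id) => //.
  by rewrite mem_index_iota.
have l0 : (0 < l)%N by apply: max_l; rewrite ?j0 // /lambdaf big_geq //; lia.
have [lj l1] : (1 <= l <= j)%N /\ 1 <= lambdaf q c j d l.
  (* The alternative 0, the value of an empty maximum, makes the property stable under the iterated
     maximum; [l0] then excludes it. *)
  have [] : l = 0%N \/ (1 <= l <= j)%N /\ 1 <= lambdaf q c j d l; last by [].
    rewrite /l /ell big_nat_cond.
    elim/big_ind: _ => [|a b IHa IHb|i /andP[ij i1]]; first by left.
      by case: (leqP a b) => ab; rewrite /maxn ?[(a < b)%N]ltnNge ?ab //; case: ltnP; lia.
    by right; split.
  by lia.
split=> //; case: (eqVneq l j) => [|ne]; first by left.
by right; have := max_l l.+1; lia.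
Qed.

Theorem theorem1 (q n : nat) (c : nat -> nat) (j : nat) (d : int)
    (hq : (0 < q)%N) (hn : (1 <= n)%N)
    (hc_pos : forall i : nat, (1 <= i <= n)%N -> (0 < c i)%N)
    (hc_mono : forall i : nat, (1 <= i < n)%N -> (c i.+1 <= c i)%N)
    (hj : (1 <= j <= n)%N) (hd : j%:Z <= d) :
  let l := ell q c j d in
  (Vstar q c j d)%:Z =
    j%:Z - 1 + (pif q `|Num.min (lambdaf q c j d l) (c l)%:Z|%N)%:Z
    + \sum_(1 <= i < l) ((pif q (c i))%:Z - 1).
Proof.
case/andP: hj => j0 jn; move=> l.
have [] := ellP q c j d j0 hd; rewrite -/l.
case: l => [//|m] mj; rewrite /lambdaf !sum_subz1 big_ord_recr /=.
set T := (\sum_(i < m) _)%N => l1 stop.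
pose a := absz (d - j%:Z + 1 - (T%:Z - m%:Z))%R.
have a0 : (0 < a)%N by lia.
(* Passing to the next index subtracts [thetaf q (c m.+1) - 1] from [a], so a result [<= 0] means
   that [a] is below the threshold. *)
have stop' : m.+1 = j \/ (a < thetaf q (c m.+1))%N by case: stop; lia.
have -> : d = (T + a + (j - m.+1))%N%:Z by lia.
rewrite (Vstar_greedy q n) //.
(* Both arguments of the minimum are positive, so the absolute value is only a cast. *)
set b := absz (Num.min _ _); have -> : b = minn a (c m.+1) by rewrite /b; lia.
rewrite [X in _ = _ + (X%:Z - _)]sum_predn; first by lia.
by move=> i; rewrite pif_gt0 // hc_pos //; have := ltn_ord i; lia.
Qed.
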